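(* In the $n$-body problem on the hyperbolic plane $\mathcal{H}^2$ (of curvature $-1$) with equal masses $m_1=\dots=m_n$, there do not exist hyperbolic relative equilibria with a regular $n$-gon configuration; that is, there is no hyperbolic relative equilibrium $q(t)=(q_1(t),\dots,q_n(t))$ whose points $q_1,\dots,q_n$ form a regular $n$-gon.
   Context: Model of the hyperbolic plane. $\mathcal{H}^2$ denotes the complete, simply connected two-dimensional space of constant curvature $-1$. It is represented by the Weierstrass model $\mathbb{L}^2=\{(x,y,z)\in\mathbb{R}^3: x^2+y^2-z^2=-1,\ z>0\}$, where $\mathbb{R}^3$ carries the Lorentz inner product $a\odot b=a_xb_x+a_yb_y-a_zb_z$. The hyperbolic distance is $d(p,q)=\cosh^{-1}(-p\odot q)$. The $n$-body problem. Point particles with positive masses $m_1,\dots,m_n$ and pairwise distinct positions $q_1(t),\dots,q_n(t)\in\mathbb{L}^2$ move according to $$\ddot q_i=\sum_{j\ne i}\frac{m_j\,\bigl(q_j+(q_i\odot q_j)q_i\bigr)}{\bigl(-1+(q_i\odot q_j)^2\bigr)^{3/2}}+(\dot q_i\odot\dot q_i)\,q_i,\qquad i=1,\dots,n.$$ Hyperbolic relative equilibria. Let $\mathrm{Lor}(\mathbb{L}^2,\odot)$ be the group of linear transformations of $\mathbb{R}^3$ of determinant $1$ that preserve $\odot$ and map $\mathbb{L}^2$ to itself. For $s\in\mathbb{R}$ let $$A(s)=\begin{pmatrix}1&0&0\\0&\cosh s&\sinh s\\0&\sinh s&\cosh s\end{pmatrix}.$$ A hyperbolic relative equilibrium is a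 solution of the equations of motion of the form $q_i(t)=P\,A(\omega t)\,P^{-1}q_i(0)$ for all $t\in\mathbb{R}$ and all $i=1,\dots,n$, for some $P\in\mathrm{Lor}(\mathbb{L}^2,\odot)$ and some constant $\omega\neq 0$ (the same $P$ and $\omega$ for all $i$). Regular $n$-gons. The hyperbolic circle with center $q_0$ and radius $\rho$ is the set of points of $\mathcal{H}^2$ at hyperbolic distance $\rho$ from $q_0$. Points $a_1,\dots,a_n\in\mathcal{H}^2$ form a regular $n$-gon if they lie on a hyperbolic circle and all hyperbolic distances $d(a_i,a_{i+1})$, $i=1,\dots,n$, are equal, where $a_{n+1}=a_1$.
   Formalization: The claim is stated for n ≥ 3 only; for n = 1 (a free particle on a geodesic) and n = 2 (two equal masses equidistant from a geodesic) hyperbolic relative equilibria exist that meet the literal regular n-gon condition. *)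

(* Defs.v *)
From mathcomp Require Import all_boot all_order all_algebra.
From mathcomp Require Import all_classical all_reals all_analysis.
From mathcomp Require Import ring lra.

Set Implicit Arguments.
Unset Strict Implicit.
Unset Printing Implicit Defensive.

Import Order.TTheory GRing.Theory Num.Theory.
Import numFieldNormedType.Exports.

Local Open Scope classical_set_scope.
Local Open Scope ring_scope.

Section HyperbolicFunctions.
Variable R : realType.

Definition cosh (x : R) : R := (expR x + expR (- x)) / 2.

Definition sinh (x : R) : R := (expR x - expR (- x)) / 2.

(* The nonnegative inverse of cosh; only meaningful on [1, +oo[. *)
Definition arcosh (x : R) : R := ln (x + Num.sqrt (x ^+ 2 - 1)).

Lemma arcoshK (x : R) : 1 <= x -> cosh (arcosh x) = x.
Proof.
move=> x1; rewrite /cosh /arcosh.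
have s0 : 0 <= Num.sqrt (x ^+ 2 - 1) by apply: sqrtr_ge0.
have s2 : Num.sqrt (x ^+ 2 - 1) ^+ 2 = x ^+ 2 - 1.
  by rewrite sqr_sqrtr // subr_ge0 exprn_ege1.
set s := Num.sqrt _ in s0 s2 *.
have y0 : 0 < x + s by rewrite ltr_pwDl // (lt_le_trans ltr01 x1).
rewrite expRN lnK ?posrE //.
have -> : (x + s)^-1 = x - s.
  apply: (mulfI (lt0r_neq0 y0)); rewrite divff ?lt0r_neq0 //.
  by rewrite [RHS]mulrC -subr_sqr s2 opprB addrC subrK.
by lra.
Qed.

Lemma arcosh_ge0 (x : R) : 1 <= x -> 0 <= arcosh x.
Proof. by move=> x1; rewrite ln_ge0 // ler_wpDr // sqrtr_ge0. Qed.

End HyperbolicFunctions.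

Section HyperbolicPlane.
Variable R : realType.

(* The coordinates x, y, z are the entries of index 0, 1, 2. *)
Definition lor (a b : 'cV[R]_3) : R :=
  a 0 0 * b 0 0 + a 1 0 * b 1 0 - a 2 0 * b 2 0.

Definition L2 : set 'cV[R]_3 := [set a | lor a a = - 1 /\ 0 < a 2 0].

Definition hdist (p q : 'cV[R]_3) : R := arcosh (- lor p q).

Definition Lor : set 'M[R]_3 :=
  [set P | [/\ \det P = 1,
               forall a b : 'cV[R]_3, lor (P *m a) (P *m b) = lor a b &
               forall a : 'cV[R]_3, L2 a -> L2 (P *m a)]].

Definition boost (s : R) : 'M[R]_3 :=
  \matrix_(i < 3, j < 3)
    nth 0 (nth [::] [:: [:: 1; 0; 0];
                        [:: 0; cosh s; sinh s];
                        [:: 0; sinh s; cosh s]] i) j.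

Definition hcircle (q0 : 'cV[R]_3) (rho : R) : set 'cV[R]_3 :=
  [set p | L2 p /\ hdist q0 p = rho].

(* ordS is the successor modulo n, so the vertices are in cyclic order. *)
Definition regular_ngon (n : nat) (a : 'I_n -> 'cV[R]_3) : Prop :=
  (exists q0 rho, L2 q0 /\ forall i, hcircle q0 rho (a i)) /\
  (forall i j, hdist (a i) (a (ordS i)) = hdist (a j) (a (ordS j))).

End HyperbolicPlane.

Section NBodyProblem.
Variables (R : realType) (n : nat).
Implicit Types (m : 'I_n -> R) (q : 'I_n -> R -> 'cV[R]_3).

Definition nbody_solution m q : Prop :=
  [/\ forall i t, L2 (q i t),
      forall i j t, i != j -> q i t <> q j t,
      forall i t, derivable (q i) t 1,
      forall i t, derivable (derive1 (q i)) t 1 &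
      forall i t,
        derive1 (derive1 (q i)) t =
        \sum_(j < n | j != i)
          (m j / ((- 1 + lor (q i t) (q j t) ^+ 2) `^ (3 / 2))) *:
            (q j t + lor (q i t) (q j t) *: q i t)
        + lor (derive1 (q i) t) (derive1 (q i) t) *: q i t].

Definition hyperbolic_relative_equilibrium m q : Prop :=
  nbody_solution m q /\
  exists P omega, [/\ Lor P, omega != 0 &
    forall i t, q i t = P *m boost (omega * t) *m invmx P *m q i 0].

End NBodyProblem.

(* Main.v *)
Require Import Defs.
From mathcomp Require Import all_boot all_order all_algebra.
From mathcomp Require Import all_classical all_reals all_analysis.
From mathcomp Require Import ring lra.

Import Order.TTheory GRing.Theory Num.Theory.
Import numFieldNormedType.Exports.

Set Implicit Arguments.
Unset Strict Implicit.
Unset Printing Implicit Defensive.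

Local Open Scope ring_scope.

(** A hyperbolic relative equilibrium slides every body along an equidistant
    curve of one fixed geodesic, the axis of the boost.  Let [E] be the unit
    spacelike vector orthogonal to the plane that cuts out this geodesic.
    The quantity [lor E q] is then constant along the orbit and [q] has
    acceleration [w ^+ 2 *: (q - lor E q *: E)], so the attraction felt by [q]
    must be tangent to the geodesic through [q] perpendicular to the axis:
    modulo [q] it equals [- w ^+ 2 * lor E q *: E]
    ([relative_equilibrium_force]).

    In a regular polygon with equal masses the attraction felt by a vertex
    points at the centre [c] of the polygon instead.  For this, an orthonormal
    frame at [c] ([hyperbolic_frame]) turns the vertices into points of a
    Euclidean circle.  Equal sides and distinct vertices force consecutive
    vertices to differ by one and the same rotation
    ([cyclic_planar_rotation]), so [lor (u i) (u j)] depends only on the class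
    of [i - j] up to sign, and the components of the forces along the chord
    [u (i + 1) - u (i - 1)], tangent to the circle at [u i], cancel
    ([cyclic_sum_balance]).  The component towards [c] does not vanish, as all
    the other bodies pull inwards.

    Comparing the two descriptions ([regular_ngon_not_axial]), [lor E (u i)]
    is nonzero and [E] is orthogonal to each of the chords
    [u (i + 1) - u (i - 1)].  So every vertex lies on the perpendicular from
    [c] to the axis.  This perpendicular meets the circle in two
    points only, whereas there are at least three vertices. *)

(** * The Lorentz form and the hyperboloid *)

Section LorentzForm.
Context {R : realType}.
Implicit Types (a b u v q c : 'cV[R]_3) (k : R).

Lemma lorC a b : lor a b = lor b a.
Proof. by rewrite /lor; ring. Qed.

Lemma lorDl u v b : lor (u + v) b = lor u b + lor v b.
Proof. by rewrite /lor !mxE; ring. Qed.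

Lemma lorZl k u b : lor (k *: u) b = k * lor u b.
Proof. by rewrite /lor !mxE; ring. Qed.

Lemma lorBl u v b : lor (u - v) b = lor u b - lor v b.
Proof. by rewrite /lor !mxE; ring. Qed.

Lemma lorBr b u v : lor b (u - v) = lor b u - lor b v.
Proof. by rewrite /lor !mxE; ring. Qed.

Lemma lorZr k b u : lor b (k *: u) = k * lor b u.
Proof. by rewrite /lor !mxE; ring. Qed.

Lemma lor_suml (I : finType) (A : pred I) (F : I -> 'cV[R]_3) b :
  lor (\sum_(i | A i) F i) b = \sum_(i | A i) lor (F i) b.
Proof.
apply: (big_morph (fun u => lor u b)) => [u v|]; first exact: lorDl.
by rewrite /lor !mxE !mul0r subr0 addr0.
Qed.

(** The reversed Cauchy-Schwarz inequality for timelike vectors; it puts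
    [- lor a b] in the range on which [arcosh] inverts [cosh]. *)
Lemma L2_lor_le a b : L2 a -> L2 b -> 1 <= - lor a b.
Proof.
rewrite /L2 /lor /= => -[ha a2] [hb b2].
move: ha hb a2 b2.
set x := a 0 0; set y := a 1 0; set z := a 2 0.
set x' := b 0 0; set y' := b 1 0; set z' := b 2 0 => ha hb z0 z'0.
(* Lagrange's identity writes the difference as a sum of three squares. *)
have sq : (1 + x * x' + y * y') ^+ 2 <= (z * z') ^+ 2.
  have hz : z ^+ 2 = 1 + x ^+ 2 + y ^+ 2 by lra.
  have hz' : z' ^+ 2 = 1 + x' ^+ 2 + y' ^+ 2 by lra.
  rewrite exprMn hz hz' -subr_ge0.
  rewrite (_ : _ - _ = (x - x') ^+ 2 + (y - y') ^+ 2 + (x * y' - y * x') ^+ 2);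
    last by ring.
  by rewrite !addr_ge0 ?sqr_ge0.
have : 1 + x * x' + y * y' <= z * z'.
  apply: (le_trans (ler_norm _)).
  by rewrite -ler_sqr ?nnegrE ?mulr_ge0 ?(ltW z0) ?(ltW z'0) // real_normK ?num_real.
by lra.
Qed.

(** The frame [f1], [f2] is the parallel transport to [c], along the geodesic
    from the apex [(0, 0, 1)], of the two horizontal coordinate vectors.  The
    expansion of a vector in [c], [f1], [f2] contains all the orthogonality
    relations that matter: paired with a second vector it gives the form as
    minus one product plus a Euclidean scalar product in the plane. *)
Lemma hyperbolic_frame c : L2 c ->
  exists f1 f2, forall u, u = - lor c u *: c + lor f1 u *: f1 + lor f2 u *: f2.
Proof.
rewrite /L2 /lor /=; set x := c 0 0; set y := c 1 0; set z := c 2 0.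
case=> hc z0.
have w0 : 1 + z != 0 by rewrite gt_eqF //; lra.
pose k := (1 + z)^-1; pose N := x ^+ 2 + y ^+ 2.
have hN : N = (1 + z) * (z - 1) by rewrite /N; lra.
have K1 : z - 1 - k * N = 0 by rewrite hN /k mulKf // subrr.
have K2 : 1 - 2 * k - k ^+ 2 * N = 0 by rewrite hN /k; field.
have K3 : 1 - z ^+ 2 + N = 0 by rewrite hN; ring.
pose mk s t r : 'cV[R]_3 := \col_i nth 0 [:: s; t; r] i.
exists (mk (1 + x ^+ 2 * k) (x * y * k) x), (mk (x * y * k) (1 + y ^+ 2 * k) y).
move=> u; apply/colP => i; rewrite !mxE /=; apply/eqP; rewrite -subr_eq0; apply/eqP.
set u0 := u 0 0; set u1 := u 1 0; set u2 := u 2 0.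
have [->|[->|->]] : i = 0 \/ i = 1 \/ i = 2.
  by case: i => -[|[|[|//]]] hi; [left|right; left|right; right]; apply/val_inj.
- rewrite -/x -/u0 /=.
  transitivity (x ^+ 2 * u0 * (1 - 2 * k - k ^+ 2 * N)
    + x * y * u1 * (1 - 2 * k - k ^+ 2 * N) - x * u2 * (z - 1 - k * N)).
    by rewrite /N; ring.
  by rewrite K1 K2; ring.
- rewrite -/y -/u1 /=.
  transitivity (y ^+ 2 * u1 * (1 - 2 * k - k ^+ 2 * N)
    + x * y * u0 * (1 - 2 * k - k ^+ 2 * N) - y * u2 * (z - 1 - k * N)).
    by rewrite /N; ring.
  by rewrite K1 K2; ring.
- rewrite -/z -/u2 /=.
  transitivity ((x * u0 + y * u1) * (z - 1 - k * N)
    + u2 * (1 - z ^+ 2 + N)).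
    by rewrite /N; ring.
  by rewrite K1 K3; ring.
Qed.

End LorentzForm.

(** * Motion generated by boosts *)

Section Motion.
Context {R : realType}.

Lemma is_derive_scalel (f : R -> R) (v : 'cV[R]_3) (t df : R) :
  is_derive t 1 f df -> is_derive t 1 (fun s => f s *: v) (df *: v).
Proof.
move=> fd.
have dif : differentiable f t by apply/derivable1_diffP.
apply: DeriveDef; first by apply/diff_derivable/differentiableZl.
rewrite deriveE; last exact: differentiableZl.
rewrite diffZl //= -deriveE //.
by rewrite derive_val.
Qed.

Lemma is_derive_exp_scale (w : R) (v : 'cV[R]_3) (t : R) :
  is_derive t 1 (fun s => expR (w * s) *: v) (expR (w * t) *: (w *: v)).
Proof.
have dw : is_derive t 1 (fun s => w * s) w.
  by apply: is_derive_eq; exact: mulr1.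
have := is_derive_scalel v
  (is_derive1_comp (is_derive_expR (w * t)) dw).
by rewrite scalerA.
Qed.

(** The vector fixed by every [boost s], normal to the plane [x = 0] that cuts
    out their common axis. *)
Let e1 : 'cV[R]_3 := delta_mx 0 0.

Lemma lor_e1 (a : 'cV[R]_3) : lor e1 a = a 0 0.
Proof. by rewrite /lor !mxE /=; ring. Qed.

Lemma mul_e00mx (a : 'cV[R]_3) : (delta_mx 0 0 : 'M[R]_3) *m a = a 0 0 *: e1.
Proof.
apply/colP => i; rewrite !mxE !big_ord_recl big_ord0 !mxE.
by case: i => -[|[|[|//]]] hi /=; ring.
Qed.

Lemma boost_row0 s (a : 'cV[R]_3) : (boost s *m a) 0 0 = a 0 0.
Proof. by rewrite !mxE !big_ord_recl big_ord0 !mxE /=; ring. Qed.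

(** Splitting along the eigenvectors of the boost: each summand is an
    exponential times a constant matrix, which makes differentiation linear
    algebra. *)
Lemma boost_exp : exists Bp Bm : 'M[R]_3, forall s,
  boost s = delta_mx 0 0 + expR s *: Bp + expR (- s) *: Bm.
Proof.
pose B (k : R) : 'M[R]_3 := \matrix_(i, j)
  nth 0 (nth [::] [:: [:: 0; 0; 0]; [:: 0; 1 / 2; k / 2]; [:: 0; k / 2; 1 / 2]] i) j.
exists (B 1), (B (- 1)) => x; apply/matrixP => i j; rewrite !mxE.
case: i => -[|[|[|//]]] hi; case: j => -[|[|[|//]]] hj;
  rewrite /= ?/cosh ?/sinh; lra.
Qed.

(** The constant term is kept as an explicit [0] in the derivative, so that
    the lemma can be applied to its own right-hand side. *)
Lemma derive1_exp2 (w : R) (v0 v1 v2 : 'cV[R]_3) :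
  derive1 (fun s => v0 + expR (w * s) *: v1 + expR (- w * s) *: v2) =
  (fun s => 0 + expR (w * s) *: (w *: v1) + expR (- w * s) *: (- w *: v2)).
Proof.
apply/funext => t; rewrite derive1E.
apply: derive_val.
apply: is_deriveD; last exact: is_derive_exp_scale.
by apply: is_deriveD; last exact: is_derive_exp_scale.
Qed.

(** The generator of the boosts squares to the projection away from the
    normal, conjugated here by [P]. *)
Lemma derive2_boost (P : 'M[R]_3) (w : R) (v : 'cV[R]_3) t : Lor P ->
  let q s := P *m boost (w * s) *m invmx P *m v in
  derive1 (derive1 q) t = w ^+ 2 *: (q t - lor (P *m e1) (q t) *: (P *m e1)).
Proof.
case=> _ lorP _ q.
have [Bp [Bm hB]] := boost_exp.
pose a := invmx P *m v.
pose v0 := P *m delta_mx 0 0 *m a.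
have qE : q = fun s => v0 + expR (w * s) *: (P *m Bp *m a)
                     + expR (- w * s) *: (P *m Bm *m a).
  apply/funext => s; rewrite /q hB -mulNr !mulmxDr !mulmxDl -!scalemxAr -!scalemxAl.
  by rewrite /v0 /a !mulmxA.
have -> : lor (P *m e1) (q t) *: (P *m e1) = v0.
  by rewrite /q -!mulmxA lorP lor_e1 boost_row0 -/a /v0 -mulmxA mul_e00mx scalemxAr.
clearbody q; rewrite qE !derive1_exp2.
apply/colP => i; rewrite !mxE; ring.
Qed.

(** Pairing the equation of motion with a tangent vector [Y] at [q i t] removes
    every multiple of [q i t], in particular the constraint force, which is
    quadratic in the velocity. *)
Lemma relative_equilibrium_force n (m : 'I_n -> R) q :
  hyperbolic_relative_equilibrium m q ->
  exists E w, lor E E = 1 /\ forall i t Y, lor (q i t) Y = 0 ->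
    \sum_(j < n | j != i)
       m j / ((- 1 + lor (q i t) (q j t) ^+ 2) `^ (3 / 2)) * lor (q j t) Y
    = - w ^+ 2 * lor E (q i t) * lor E Y.
Proof.
case=> -[_ _ _ _ eom] [P [w [LP _ qE]]].
have [_ lorP _] := LP.
exists (P *m e1), w; split; first by rewrite lorP lor_e1 mxE.
move=> i t Y qY.
have := derive2_boost w (q i 0) t LP.
rewrite /= -(funext (qE i)) -qE eom => /(congr1 (fun u => lor u Y)).
rewrite lorDl !lorZl lorBl lorZl lor_suml qY mulr0 addr0 sub0r => sumE.
rewrite (_ : - w ^+ 2 * _ * _ = w ^+ 2 * - (lor (P *m e1) (q i t) * lor (P *m e1) Y));
  last by ring.
by rewrite -sumE; apply: eq_bigr => j _; rewrite lorZl lorDl lorZl qY mulr0 addr0.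
Qed.

End Motion.

(** * Cyclic configurations in the plane *)

Section Cyclic.
Context {R : realType}.

(** The point reflection [j |-> i + i - j] of the index group exchanges the two
    sums.  With [g] the Gram matrix of a regular polygon, this is its mirror
    symmetry about the axis through the vertex [i]. *)
Lemma cyclic_sum_balance (I : finZmodType) (g : I -> I -> R) (f : R -> R) i k :
  (forall x y, g x y = g y x) ->
  (forall x y h, g (x + h) (y + h) = g x y) ->
  \sum_(j | j != i) f (g i j) * g j (i + k)
  = \sum_(j | j != i) f (g i j) * g j (i - k).
Proof.
move=> gC gD.
have inv : involutive (fun j => i + i - j) by move=> j; rewrite opprB addrC subrK.
rewrite (reindex_inj (inv_inj inv)) /=; apply: eq_big => j.
  by rewrite subr_eq [i + i == _](inj_eq (addrI i)) eq_sym.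
move=> _; rewrite -(gD i _ (j - i)) (addrC i) subrK.
rewrite -(gD _ (i + k) (j - i - k)).
rewrite (_ : i + i - j + (j - i) = i); last by rewrite -addrA addKr addrK.
rewrite (_ : i + k + (j - i - k) = j); last first.
  by rewrite addrC [i + k]addrC addrA !subrK.
rewrite (_ : i + i - j + (j - i - k) = i - k); last first.
  by rewrite addrA -[_ - j + _]addrA addKr addrK.
by rewrite [g j i]gC [g (i - k) j]gC.
Qed.

Lemma ord_succ_neq_pred n (i : 'I_n.+3) : i + 1 != i - 1.
Proof.
rewrite (inj_eq (addrI i)) -addr_eq0.
by apply/eqP => /(congr1 val) /=; rewrite !modn_small.
Qed.

Lemma ord_succ_neq n (i : 'I_n.+3) : i + 1 != i.
Proof. by rewrite -subr_eq0 addrC addKr. Qed.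

Lemma cyclic_cst n (T : Type) (X : 'I_n.+3 -> T) :
  (forall i, X (i + 1) = X i) -> forall i j, X i = X j.
Proof.
move=> XS.
suff X0 i : X i = X 0 by move=> i j; rewrite !X0.
rewrite -[i](natr_Zp (i : 'Z_n.+3)); elim: (val i) => [|k IH]; first by rewrite mulr0n.
by rewrite mulrSr XS.
Qed.

(** On a circle the scalar product of neighbours fixes the step from [i] to
    [i + 1] up to the sign of the cross product [X i].  A change of sign would
    bring [i + 1] back to [i - 1], so one rotation performs all the steps, and
    rotations preserve scalar products. *)
Lemma cyclic_planar_rotation n (a b : 'I_n.+3 -> R) (r s : R) :
  (forall i, a i ^+ 2 + b i ^+ 2 = r) ->
  (forall i, a i * a (i + 1) + b i * b (i + 1) = s) ->
  (forall i j, a i = a j -> b i = b j -> i = j) ->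
  forall i j k, a (i + k) * a (j + k) + b (i + k) * b (j + k) = a i * a j + b i * b j.
Proof.
move=> hr hs inj.
(* A circle of radius 0 has no room for two distinct points. *)
have r0 : r != 0.
  apply/eqP => r0; have z i : a i = 0 /\ b i = 0.
    have := hr i; rewrite r0 => /eqP.
    by rewrite paddr_eq0 ?sqr_ge0 // !sqrf_eq0 => /andP[/eqP ? /eqP ?].
  have [a0 b0] := z 0; have [a1 b1] := z 1.
  by have := inj 0 1; rewrite a0 b0 a1 b1 => /(_ erefl erefl).
pose X i := a i * b (i + 1) - b i * a (i + 1).
(* The point i + 1, then the point i - 1, in the orthogonal basis formed by
   the point i and its image under a quarter turn. *)
have aS i : r * a (i + 1) = s * a i - X i * b i.
  by rewrite -(hr i) -(hs i) /X; ring.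
have bS i : r * b (i + 1) = s * b i + X i * a i.
  by rewrite -(hr i) -(hs i) /X; ring.
have aP i : r * a (i - 1) = s * a i + X (i - 1) * b i.
  by rewrite -(hr i) -(hs (i - 1)) /X subrK; ring.
have bP i : r * b (i - 1) = s * b i - X (i - 1) * a i.
  by rewrite -(hr i) -(hs (i - 1)) /X subrK; ring.
have X2 i : X i ^+ 2 = r ^+ 2 - s ^+ 2.
  transitivity ((a i ^+ 2 + b i ^+ 2) * (a (i + 1) ^+ 2 + b (i + 1) ^+ 2)
    - (a i * a (i + 1) + b i * b (i + 1)) ^+ 2); first by rewrite /X; ring.
  by rewrite !hr hs.
have XP i : X i = X (i - 1).
  have /eqP : X i ^+ 2 = X (i - 1) ^+ 2 by rewrite !X2.
  rewrite eqf_sqr => /orP[/eqP //|/eqP XN].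
  have := ord_succ_neq_pred i => /eqP[]; apply: inj; apply: (mulfI r0).
    by rewrite aS aP XN; ring.
  by rewrite bS bP XN; ring.
have XE i j : X i = X j by apply: cyclic_cst => k; rewrite XP addrK.
have step i j : a (i + 1) * a (j + 1) + b (i + 1) * b (j + 1) = a i * a j + b i * b j.
  have rr : r * r != 0 by rewrite mulf_neq0.
  apply: (mulfI rr).
  transitivity ((r * a (i + 1)) * (r * a (j + 1)) + (r * b (i + 1)) * (r * b (j + 1))).
    by ring.
  rewrite !aS !bS (XE j i).
  transitivity ((s ^+ 2 + X i ^+ 2) * (a i * a j + b i * b j)); first by ring.
  by rewrite X2; ring.
move=> i j k.
pose h k := a (i + k) * a (j + k) + b (i + k) * b (j + k).
have -> : a i * a j + b i * b j = h 0 by rewrite /h !addr0.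
by apply: (cyclic_cst (X := h)) => l; rewrite /h !addrA step.
Qed.

End Cyclic.

(** * The force on a vertex of a regular polygon *)

Section Static.
Context {R : realType}.

(** The attraction may have any law [f] that is positive at the inner products
    of distinct points.  A force proportional to [E] modulo [u i], as boosts
    require, cannot also point at the centre of the polygon for all [i]: the
    directions from the vertices to the centre would all be perpendicular to
    one geodesic. *)
Lemma regular_ngon_not_axial n (u : 'I_n.+3 -> 'cV[R]_3) (f : R -> R) (E : 'cV[R]_3) (W : R) :
  (forall i, L2 (u i)) -> injective u -> regular_ngon u ->
  (forall x, x < - 1 -> 0 < f x) -> lor E E = 1 ->
  ~ (forall i Y, lor (u i) Y = 0 ->
       \sum_(j | j != i) f (lor (u i) (u j)) * lor (u j) Y
       = W * lor E (u i) * lor E Y).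
Proof.
move=> uL u_inj [[c [rho [cL circ]]] side] f0 E1 force.
have coshd (p q : 'cV[R]_3) : L2 p -> L2 q -> cosh (hdist p q) = - lor p q.
  by move=> pL qL; apply/arcoshK/L2_lor_le.
pose C := cosh rho.
have cu i : lor c (u i) = - C.
  by have [_ rhoE] := circ i; rewrite /C -rhoE coshd // opprK.
have C1 : 1 <= C by rewrite -[C]opprK -(cu 0); exact: L2_lor_le.
have uS i : lor (u i) (u (i + 1)) = lor (u 0) (u 1).
  apply: oppr_inj; rewrite -!coshd //; congr cosh.
  by have := side i 0; rewrite -!(add_Zp_1 (_ : 'Z_n.+3)) add0r.
have [f1 [f2 frame]] := hyperbolic_frame cL.
have lorE v w : lor v w = - lor c v * lor c w + lor f1 v * lor f1 w + lor f2 v * lor f2 w.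
  by rewrite {1}(frame v) !lorDl !lorZl.
pose a i := lor f1 (u i); pose b i := lor f2 (u i).
have uuE i j : lor (u i) (u j) = - C ^+ 2 + (a i * a j + b i * b j).
  by rewrite lorE !cu /a /b; ring.
have ab_inj i j : a i = a j -> b i = b j -> i = j.
  by move=> aij bij; apply: u_inj; rewrite (frame (u i)) (frame (u j)) !cu -/(a i) -/(b i) aij bij.
have uu i : lor (u i) (u i) = - 1 by have [] := uL i.
have abr i : a i ^+ 2 + b i ^+ 2 = C ^+ 2 - 1.
  by have := uuE i i; rewrite uu; lra.
have shift i j k : lor (u (i + k)) (u (j + k)) = lor (u i) (u j).
  rewrite !uuE; congr (_ + _).
  apply: (cyclic_planar_rotation (r := C ^+ 2 - 1) (s := lor (u 0) (u 1) + C ^+ 2)) => // l.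
  by rewrite -(uS l) uuE; lra.
(* Both vectors have norm -1, so 1 + lor (u i) (u j) is minus half the
   squared distance of the planar images. *)
have uu_lt i j : j != i -> lor (u i) (u j) < - 1.
  move=> ji; rewrite lt_neqAle; apply/andP; split; last first.
    by have := L2_lor_le (uL i) (uL j); lra.
  apply: contra ji => /eqP uij.
  have : (a j - a i) ^+ 2 + (b j - b i) ^+ 2 = 0.
    by have := uuE i j; have := abr i; have := abr j; rewrite uij; lra.
  move/eqP; rewrite paddr_eq0 ?sqr_ge0 // !sqrf_eq0 !subr_eq0 => /andP[/eqP ? /eqP ?].
  by apply/eqP/ab_inj.
pose x i := lor E (u i).
(* Test vector: the direction from u i to the centre, along which every other
   vertex pulls with positive strength. *)
have Wx i : W * x i != 0.
  apply/eqP => Wx0.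
  have := force i (c - C *: u i).
  rewrite lorBr lorZr uu lorC cu -/(x i) Wx0 mul0r mulrN1 subrr => /(_ erefl) sum0.
  have pos j : j != i -> 0 < f (lor (u i) (u j)) * lor (u j) (c - C *: u i).
    move=> ji; rewrite mulr_gt0 ?f0 ?uu_lt // lorBr lorZr lorC cu [lor (u j) _]lorC.
    have := uu_lt _ _ ji; nra.
  have /psumr_eq0P := sum0.
  move=> /(_ (fun j ji => ltW (pos j ji))) /(_ (i + 1) (ord_succ_neq i)) /eqP.
  by rewrite gt_eqF // pos // ord_succ_neq.
(* Test vector: the chord joining the neighbours of u i, along which the
   forces cancel. *)
have xper i : x (i + 1) = x (i - 1).
  have sym : lor (u i) (u (i + 1)) = lor (u i) (u (i - 1)).
    by rewrite [RHS]lorC -(shift (i - 1) i 1) subrK.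
  have := force i (u (i + 1) - u (i - 1)).
  rewrite !lorBr sym subrr => /(_ erefl).
  under eq_bigr do rewrite lorBr mulrBr.
  rewrite sumrB (@cyclic_sum_balance _ _ (fun i j => lor (u i) (u j)) f) //; last first.
    by move=> ? ?; exact: lorC.
  rewrite subrr => /esym/eqP; rewrite mulf_eq0 (negbTE (Wx i)) subr_eq0 /=.
  by move/eqP.
(* (l, k) is the planar part of E; it cannot vanish, since E is spacelike and
   c is timelike. *)
pose l := lor f1 E; pose k := lor f2 E.
have xE i : x i = lor c E * C + (l * a i + k * b i) by rewrite /x lorC lorE cu /a /b /l /k; ring.
have lk : l ^+ 2 + k ^+ 2 != 0.
  have := lorE E E; rewrite E1 -/l -/k => h.
  by rewrite gt_eqF //; have := sqr_ge0 (lor c E); lra.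
(* The chord (w1, w2) is orthogonal to (l, k) and to the image of u i, and it
   is nonzero; in the plane these two must then be parallel. *)
have par i : l * b i = k * a i.
  pose w1 := a (i + 1) - a (i - 1); pose w2 := b (i + 1) - b (i - 1).
  have lw : l * w1 + k * w2 = 0 by have := xper i; rewrite !xE /w1 /w2; lra.
  have aw : a i * w1 + b i * w2 = 0.
    have := shift (i - 1) i 1; rewrite subrK [RHS]lorC !uuE /w1 /w2; lra.
  have d1 : (l * b i - k * a i) * w1 = 0.
    by rewrite (_ : _ * w1 = b i * (l * w1 + k * w2) - k * (a i * w1 + b i * w2));
      [rewrite lw aw; ring | ring].
  have d2 : (l * b i - k * a i) * w2 = 0.
    by rewrite (_ : _ * w2 = l * (a i * w1 + b i * w2) - a i * (l * w1 + k * w2));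
      [rewrite lw aw; ring | ring].
  apply/eqP; rewrite -subr_eq0; apply: contraT => d0.
  move/eqP: d1; rewrite mulf_eq0 (negbTE d0) /= subr_eq0 => /eqP a1.
  move/eqP: d2; rewrite mulf_eq0 (negbTE d0) /= subr_eq0 => /eqP b1.
  by move: (ord_succ_neq_pred i); rewrite (ab_inj _ _ a1 b1) eqxx.
(* Being parallel to (l, k), a planar image is determined by its scalar product
   with (l, k), which is the same for the indices 1 and -1. *)
have aE i : (l ^+ 2 + k ^+ 2) * a i = l * (l * a i + k * b i).
  by rewrite mulrDl !expr2 -!mulrA -par; ring.
have bE i : (l ^+ 2 + k ^+ 2) * b i = k * (l * a i + k * b i).
  by rewrite mulrDl !expr2 -!mulrA par; ring.
have xx : l * a (0 + 1) + k * b (0 + 1) = l * a (0 - 1) + k * b (0 - 1).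
  by have := xper 0; rewrite !xE; lra.
have := ord_succ_neq_pred (0 : 'I_n.+3) => /eqP[].
by apply: ab_inj; apply: (mulfI lk); rewrite ?aE ?bE xx.
Qed.

End Static.

(** * Nonexistence of regular polygonal hyperbolic relative equilibria *)

Theorem theorem3 (R : realType) (n : nat) (hn : (3 <= n)%N) (m : 'I_n -> R)
    (m_gt0 : forall i, 0 < m i) (m_eq : forall i j, m i = m j) :
  ~ exists q : 'I_n -> R -> 'cV[R]_3,
      hyperbolic_relative_equilibrium m q /\
      exists t : R, regular_ngon (fun i => q i t).
Proof.
case=> q [requil [t ngon]].
have [E [w [E1 force]]] := relative_equilibrium_force requil.
case: requil => -[qL q_dist _ _ _] _.
case: n hn m m_gt0 m_eq q ngon force qL q_dist => [|[|[|n]]] // _ m m_gt0 m_eq q.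
move=> ngon force qL q_dist.
pose f (x : R) := m 0 / ((- 1 + x ^+ 2) `^ (3 / 2)).
apply: (@regular_ngon_not_axial _ _ (fun i => q i t) f E (- w ^+ 2)) => //.
- by move=> i j qij; apply/eqP; apply: contraT => /q_dist /(_ qij).
- by move=> x x1; rewrite divr_gt0 // powR_gt0; nra.
move=> i Y /force <-; apply: eq_bigr => j _.
by rewrite /f (m_eq 0 j).
Qed.
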